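(* Let $q$ be a prime power and $n\ge 3$. Let $J_q(n+1,2)$ be the Grassmann graph whose vertices are the lines of the projective space $\operatorname{PG}(n,q)$, two distinct lines being adjacent if and only if they intersect. There is a one-to-one correspondence between optimal $-(q+1)$-eigenfunctions of $J_q(n+1,2)$ and reguli in $3$-dimensional subspaces of $\operatorname{PG}(n,q)$. Explicitly, a function $f$ on the vertices is an optimal $-(q+1)$-eigenfunction if and only if there are a regulus $R$ contained in some $3$-dimensional subspace of $\operatorname{PG}(n,q)$ and a constant $c\neq 0$ such that $f=c$ on the lines of $R$, $f=-c$ on the lines of the opposite regulus $R^{opp}$, and $f=0$ on all other lines.
   Context: $\operatorname{PG}(n,q)$ is the geometry whose points, lines, planes, ... are the subspaces of dimension $1,2,3,\dots$ of an $(n+1)$-dimensional vector space over $\mathbb{F}_q$. For a graph $G$ and an eigenvalue $\theta$ of its adjacency matrix, a $\theta$-eigenfunction is a real-valued function $f\not\equiv 0$ on $V(G)$ with $\theta f(u)=\sum_{w\sim u} f(w)$ for every vertex $u$. An eigenfunction is optimal if it has the minimum number of nonzero values (cardinality of support) among all eigenfunctions for that eigenvalue. A set of lines is skew if no two of them share a point; a transversal of a set $S$ of skew lines is a line meeting each line of $S$ in exactly one point. In a $3$-dimensional projective space, a regulus is a nonempty set $R$ of pairwise skew lines such that (1) through each point of each line of $R$ there is a transversal of $R$, and (2) through each point of a transversal of $R$ there is a line of $R$. The set $R^{opp}$ of all transversals of $R$ is again a regulus, the opposite regulus; over $\mathbb{F}_q$ each regulus has $q+1$ lines. *)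

(* Defs.v *)
From HB Require Import structures.
From mathcomp Require Import all_boot all_order all_algebra.
From mathcomp Require Import reals.

Set Implicit Arguments.
Unset Strict Implicit.
Unset Printing Implicit Defensive.

Import Order.TTheory GRing.Theory Num.Theory.
Local Open Scope ring_scope.

Section FiniteVspace.
Variables (F : finFieldType) (V : vectType F).
Let vs2mx_pcan := can_pcan (@VectorInternalTheory.vs2mxK F V).

HB.instance Definition _ :=
  Choice_isCountable.Build {vspace V} (pcan_pickleK vs2mx_pcan).
HB.instance Definition _ :=
  isFinite.Build {vspace V} (pcan_enumP vs2mx_pcan).

End FiniteVspace.

Section Eigenfunctions.
Variables (R : realType) (T : finType) (adj : rel T).

Definition eigenfunction (theta : R) (f : T -> R) : Prop :=
  (exists u, f u != 0) /\
  (forall u, theta * f u = \sum_(w | adj u w) f w).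

Definition support_size (f : T -> R) : nat := #|[set u | f u != 0]|.

Definition optimal_eigenfunction (theta : R) (f : T -> R) : Prop :=
  eigenfunction theta f /\
  (forall g, eigenfunction theta g -> (support_size f <= support_size g)%N).

End Eigenfunctions.

Section ProjectiveGeometry.
Variables (F : finFieldType) (V : vectType F).

(* Dimensions are linear, so a projective 3-space is a 4-dimensional
   subspace of V. *)
Definition point : predArgType := {P : {vspace V} | \dim P == 1%N}.
Definition line : predArgType := {L : {vspace V} | \dim L == 2%N}.
Definition solid : predArgType := {W : {vspace V} | \dim W == 4%N}.
HB.instance Definition _ := SubFinite.on point.
HB.instance Definition _ := SubFinite.on line.
HB.instance Definition _ := SubFinite.on solid.

Definition points_on (l : line) : {set point} :=
  [set p : point | (val p <= val l)%VS].

Definition common_points (l m : line) : {set point} :=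
  points_on l :&: points_on m.

Definition grassmann_adj : rel line :=
  fun l m => (l != m) && (common_points l m != set0).

Definition skew (S : {set line}) : Prop :=
  {in S &, forall l m, l != m -> common_points l m = set0}.

(* The transversals are those of the ambient projective 3-space W. *)
Definition transversals (W : solid) (S : {set line}) : {set line} :=
  [set t : line | (val t <= val W)%VS &
                  [forall l in S, #|common_points t l| == 1%N]].

Definition regulus (W : solid) (S : {set line}) : Prop :=
  [/\ S != set0,
      {in S, forall l, (val l <= val W)%VS},
      skew S,
      {in S, forall l p, p \in points_on l ->
         exists2 t, t \in transversals W S & p \in points_on t} &
      {in transversals W S, forall t p, p \in points_on t ->
         exists2 l, l \in S & p \in points_on l}].

Definition opposite (W : solid) (S : {set line}) : {set line} :=
  transversals W S.

Definition regulus_function (R : realType) (W : solid) (S : {set line})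
    (c : R) (f : line -> R) : Prop :=
  [/\ {in S, forall l, f l = c},
      {in opposite W S, forall l, f l = - c} &
      forall l, l \notin S -> l \notin opposite W S -> f l = 0].

End ProjectiveGeometry.

(* Main.v *)
(* Let N be the point-line incidence matrix.  Since N^T N = A + (q + 1) I, the
   eigenfunctions for -(q + 1) are the nonzero functions whose values on the
   lines through each point add up to 0.  Such a function takes a negative
   value on some line through each of the q + 1 points of a line where it is
   positive, and conversely; as two lines share at most one point, it has at
   least q + 1 positive and q + 1 negative lines.  In the case of equality
   these are two families of q + 1 pairwise skew lines, each line of one family
   meeting every line of the other, that is, a regulus and its opposite. *)

Require Import Defs.
From HB Require Import structures.
From mathcomp Require Import all_boot all_order all_algebra.
From mathcomp Require Import reals.

Set Implicit Arguments.
Unset Strict Implicit.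
Unset Printing Implicit Defensive.

Import Order.TTheory GRing.Theory Num.Theory.
Local Open Scope ring_scope.

(** * Points and lines of the projective space *)

Section Incidence.
Variables (F : finFieldType) (V : vectType F).
Implicit Types (p : point V) (l m t : line V) (U : {vspace V}).

Lemma exists_point_sub U : U != 0%VS -> exists p, (val p <= U)%VS.
Proof.
move=> U0; have d1 : \dim <[vpick U]> == 1%N by rewrite dim_vline vpick0 U0.
by exists (Sub <[vpick U]>%VS d1); rewrite SubK -memvE memv_pick.
Qed.

Lemma pointP p : exists2 v : V, v != 0 & val p = <[v]>%VS.
Proof.
case: p => P dP /=; have P0 : P != 0%VS.
  by apply: contraL dP => /eqP ->; rewrite dimv0.
exists (vpick P); first by rewrite vpick0.
apply/eqP; rewrite eq_sym eqEdim -memvE memv_pick (eqP dP).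
by rewrite dim_vline vpick0 P0.
Qed.

Lemma dim_add_points p p' : p != p' -> \dim (val p + val p') = 2%N.
Proof.
move=> pp'.
have dp : \dim (val p) = 1%N by apply/eqP/(valP p).
have dp' : \dim (val p') = 1%N by apply/eqP/(valP p').
rewrite dimv_disjoint_sum ?dp ?dp' //.
apply/eqP; apply: contraNT pp' => /exists_point_sub[r].
rewrite subv_cap => /andP[rp rp'].
have dr : \dim (val r) = 1%N by apply/eqP/(valP r).
rewrite -val_eqE; apply/eqP.
have /eqP <- : val r == val p by rewrite eqEdim rp dp dr.
by apply/eqP; rewrite eqEdim rp' dp' dr.
Qed.

Lemma line_through p p' l :
  p != p' -> p \in points_on l -> p' \in points_on l ->
  val l = (val p + val p')%VS.
Proof.
rewrite !inE => pp' pl pl'; apply/eqP; rewrite eq_sym eqEdim subv_add pl pl'.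
by rewrite dim_add_points // (eqP (valP l)).
Qed.

Lemma eq_line p p' l m : p != p' ->
  p \in points_on l -> p' \in points_on l ->
  p \in points_on m -> p' \in points_on m -> l = m.
Proof.
by move=> pp' *; apply: val_inj; rewrite /= !(@line_through p p').
Qed.

Lemma card_common_points_le1 l m : l != m -> (#|common_points l m| <= 1)%N.
Proof.
move=> lm; apply/card_le1_eqP => p p' /setIP[pl pm] /setIP[pl' pm'].
by apply/eqP; apply: contraNT lm => pp'; apply/eqP/(@eq_line p' p).
Qed.

Lemma common_points_eq0 l m :
  (common_points l m == set0) = (val l :&: val m == 0)%VS.
Proof.
apply/idP/idP.
  apply: contraTT => /exists_point_sub[p]; rewrite subv_cap => /andP[pl pm].
  by apply/set0Pn; exists p; rewrite !inE pl.
apply: contraTT => /set0Pn[p]; rewrite !inE -subv_cap => ps.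
by apply: contraTN ps => /eqP ->; rewrite subv0 -dimv_eq0 (eqP (valP p)).
Qed.

Lemma common_pointsC l m : common_points l m = common_points m l.
Proof. exact: setIC. Qed.

(** For a basis [e0], [e1] of the line, its points are the spans of [e0 + x *: e1], one for each [x]
    in [F], together with the span of [e1]; [None] indexes the latter. *)
Lemma card_points_on l : #|points_on l| = #|F|.+1.
Proof.
move: (vbasis (val l)) (vbasisP (val l)); rewrite (eqP (valP l)).
case/tupleP=> e0; case/tupleP=> e1 t; rewrite (tuple0 t) /=.
move=> /andP[/eqP ls lf]; set U := \val l in ls *.
have e1N0 : e1 != 0.
  move: lf; rewrite free_cons => /andP[_].
  by rewrite free_cons span_nil memv0 => /andP[].
have e0N : e0 \notin <[e1]>%VS.
  by move: lf; rewrite free_cons span_seq1 => /andP[].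
have lE v : v \in U -> exists x y, v = x *: e0 + y *: e1.
  rewrite -ls span_cons span_seq1.
  by move=> /memv_addP[_ /vlineP[x ->]][_ /vlineP[y ->] ->]; exists x, y.
pose g (o : option F) : V := if o is Some x then e0 + x *: e1 else e1.
have gN0 o : g o != 0.
  case: o => [x|] //=; apply: contra e0N; rewrite addr_eq0 => /eqP ->.
  by rewrite -scaleNr memvZ ?memv_line.
have gd o : \dim <[g o]> == 1%N by rewrite dim_vline gN0.
pose h o : point V := Sub <[g o]>%VS (gd o).
have gl o : g o \in U.
  rewrite -ls; case: o => [x|] /=.
    by rewrite memvD ?memvZ // memv_span ?inE ?eqxx ?orbT.
  by rewrite memv_span ?inE ?eqxx ?orbT.
have hinj : injective h.
  move=> o o' /(congr1 val); rewrite /h !SubK => /eqP.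
  rewrite eqEsubv -!memvE => /andP[/vlineP[k Hk] _].
  (* Proportionality of two generators is turned into a vanishing combination of [e0] and [e1];
     independence then identifies the parameters, or gives [1 = 0] when exactly one of them is
     [None]. *)
  have comb0 x y : x *: e0 + y *: e1 = 0 -> x = 0 /\ y = 0.
    move=> xy0; have x0 : x = 0.
      apply/eqP; apply: contraNT e0N => x0; apply/vlineP; exists (- (x^-1 * y)).
      apply/eqP; rewrite -(inj_eq (scalerI x0)) -subr_eq0.
      by rewrite scalerA mulrN mulVKf // scaleNr opprK xy0.
    split=> //; move/eqP: xy0; rewrite x0 scale0r add0r scaler_eq0.
    by rewrite (negbTE e1N0) orbF => /eqP.
  case: o o' Hk => [x|] [x'|] //= Hk.
  - have [] := comb0 (1 - k) (x - k * x').
      rewrite !scalerBl scale1r -!scalerA addrACA -opprD -scalerDr.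
      by rewrite Hk subrr.
    move=> /eqP; rewrite subr_eq0 => /eqP <-.
    by rewrite mul1r => /eqP; rewrite subr_eq0 => /eqP ->.
  - have [] := comb0 1 (x - k).
      by rewrite scale1r scalerBl addrA Hk subrr.
    by move=> /eqP; rewrite oner_eq0.
  - have [] := comb0 k (k * x' - 1).
      rewrite scalerBl scale1r -scalerA addrA -scalerDr.
      by rewrite -Hk subrr.
    by move=> -> /eqP; rewrite mul0r add0r oppr_eq0 oner_eq0.
rewrite -card_option -(card_codom hinj) -[RHS]cardsE; congr #|pred_of_set _|.
apply/setP=> p; rewrite !inE; apply/idP/idP; last first.
  by case/codomP=> o ->; rewrite SubK -memvE.
case: (pointP p) => v v0 pv; rewrite pv -memvE => /lE[x [y vE]].
apply/codomP; pose o := if x == 0 then None else Some (x^-1 * y).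
exists o; apply: val_inj; rewrite SubK /= pv; apply/eqP.
rewrite eqEdim !dim_vline v0 gN0 andbT -memvE; apply/vlineP.
rewrite {}vE /o in v0 *; case: eqP => [->|/eqP x0] /=.
  by exists y; rewrite scale0r add0r.
by exists x; rewrite scalerDr scalerA mulVKf.
Qed.

Lemma common_pointsxx l : common_points l l = points_on l.
Proof. exact: setIid. Qed.

End Incidence.

(** * Grids of lines and their equivalence with reguli *)

Section Grids.
Variables (F : finFieldType) (V : vectType F).
Implicit Types (p : point V) (l m t : line V) (W : solid V).
Implicit Types (A B S : {set line V}).

Definition covered B l := forall p, p \in points_on l ->
  exists2 m, m \in B & p \in points_on m.

(** Double counting of the pairs (point of [l], line of [A] through it): each of the q + 1 points
    contributes at least one pair, and each line of [A], being distinct from [l], at most one.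
    Equality means that all these contributions are exactly one. *)
Lemma card_covered A l : l \notin A -> covered A l ->
  (#|F|.+1 <= #|A| ?= iff
     [forall p in points_on l, #|[set m in A | p \in points_on m]| == 1%N] &&
     [forall m in A, #|common_points l m| == 1%N])%N.
Proof.
move=> lA lcov; rewrite -(card_points_on l) -!sum1_card.
have e : (\sum_(p in points_on l) #|[set m in A | p \in points_on m]| =
          \sum_(m in A) #|common_points l m|)%N.
  under eq_bigr => p _ do rewrite -sum1dep_card big_mkcondr.
  rewrite exchange_big; apply: eq_bigr => m _.
  by rewrite -big_mkcondr sum1dep_card; congr #|pred_of_set _|;
    apply/setP => p; rewrite !inE.
apply: (@leqif_trans _ (\sum_(m in A) #|common_points l m|)).
  rewrite -e; apply: leqif_sum => p pl; split; last by rewrite eq_sym.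
  by have [m mA pm] := lcov p pl; apply/card_gt0P; exists m; rewrite inE mA.
apply: leqif_sum => m mA; split=> //; apply: card_common_points_le1.
by apply: contraNneq lA => ->.
Qed.

(** Since [t] and [t'] already share [p], which is off [l], they meet [l] in two different points,
    and these span [l]. *)
Lemma sub_add_transversals p t t' l :
  t != t' -> p \in points_on t -> p \in points_on t' -> p \notin points_on l ->
  common_points t l != set0 -> common_points t' l != set0 ->
  (val l <= val t + val t')%VS.
Proof.
move=> tt' pt pt' pl /set0Pn[r /setIP[rt rl]] /set0Pn[r' /setIP[rt' rl']].
have rr' : r != r'.
  apply: contraNneq tt' => rr'; apply/eqP; apply: (@eq_line _ _ p r) => //.
    by apply: contraNneq pl => ->.
  by rewrite rr'.
rewrite (line_through rr' rl rl'); apply: addvS; first by rewrite !inE in rt.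
by rewrite inE in rt'.
Qed.

(* Two transversals through a common point span a plane containing both l2 and
   l3, which would then meet. *)
Lemma transversal_unique l1 l2 l3 p t t' :
  common_points l1 l2 = set0 -> common_points l1 l3 = set0 ->
  common_points l2 l3 = set0 ->
  p \in points_on l1 -> p \in points_on t -> p \in points_on t' ->
  common_points t l2 != set0 -> common_points t' l2 != set0 ->
  common_points t l3 != set0 -> common_points t' l3 != set0 -> t = t'.
Proof.
move=> s12 s13 /eqP; rewrite common_points_eq0 => s23 pl1 pt pt' t2 t2' t3 t3'.
apply/eqP/negPn/negP=> tt'.
have nin l : common_points l1 l = set0 -> p \notin points_on l.
  by move=> s; apply/negP=> pl; move: (in_set0 p); rewrite -s inE pl1 pl.
have l2le := sub_add_transversals tt' pt pt' (nin _ s12) t2 t2'.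
have l3le := sub_add_transversals tt' pt pt' (nin _ s13) t3 t3'.
have d23 : \dim (val l2 + val l3) = 4%N.
  by rewrite dimv_disjoint_sum ?(eqP (valP l2)) ?(eqP (valP l3)) // (eqP s23).
have := dimvS (addvS l2le l3le); rewrite addvv d23.
have : common_points t t' != set0 by apply/set0Pn; exists p; rewrite inE pt.
rewrite common_points_eq0 -dimv_eq0.
have := dimv_sum_cap (val t) (val t').
rewrite (eqP (valP t)) (eqP (valP t')).
by rewrite -lt0n => e y0 x4; have := leq_add x4 y0; rewrite e.
Qed.

Lemma dim_add_skew l m : common_points l m = set0 -> \dim (val l + val m) = 4%N.
Proof.
move=> /eqP; rewrite common_points_eq0 => /eqP lm.
by rewrite dimv_disjoint_sum // (eqP (valP l)) (eqP (valP m)).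
Qed.

Lemma solid_eq_add l m W : common_points l m = set0 ->
  (val l <= val W)%VS -> (val m <= val W)%VS -> val W = (val l + val m)%VS.
Proof.
move=> lm lW mW; apply/eqP; rewrite eq_sym eqEdim subv_add lW mW.
by rewrite dim_add_skew // (eqP (valP W)).
Qed.

(* By counting, this forces A and B to be the two rulings of a hyperbolic
   quadric. *)
Definition grid A B :=
  [/\ #|A| = #|F|.+1, #|B| = #|F|.+1, [disjoint A & B],
      {in A, forall l, covered B l} & {in B, forall m, covered A m}].

Lemma grid_sym A B : grid A B -> grid B A.
Proof. by case; split; rewrite // disjoint_sym. Qed.

(** The sizes in a grid put [card_covered] in its equality case; its second condition is used here,
    and its first one in [grid_unique]. *)
Lemma grid_card_common A B l m :
  grid A B -> l \in A -> m \in B -> #|common_points l m| = 1%N.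
Proof.
case=> cA cB dAB cov _ lA mB.
have [_] := card_covered (negbT (disjointFr dAB lA)) (cov l lA).
by rewrite cB eqxx => /esym/andP[_ /forall_inP/(_ m mB)/eqP].
Qed.

Lemma grid_unique A B l m m' p : grid A B -> l \in A -> m \in B -> m' \in B ->
  p \in points_on l -> p \in points_on m -> p \in points_on m' -> m = m'.
Proof.
case=> cA cB dAB cov _ lA mB mB' pl pm pm'.
have [_] := card_covered (negbT (disjointFr dAB lA)) (cov l lA).
rewrite cB eqxx => /esym/andP[/forall_inP/(_ p pl) /eqP c1 _].
move/eq_leq/card_le1_eqP: c1; apply; rewrite inE; exact/andP.
Qed.

(** A common point of two lines of [B] would lie on a line of [A], and through each point of that
    line passes only one line of [B]. *)
Lemma grid_skew A B : grid A B -> Defs.skew B.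
Proof.
move=> gAB m m' mB mB' mm'; apply/eqP/negPn/negP => /set0Pn[p /setIP[pm pm']].
have [_ _ _ _ cov] := gAB; have [l lA pl] := cov m mB p pm.
by case/eqP: mm'; apply: (grid_unique gAB lA _ _ pl).
Qed.

Lemma card_skew_triple A l : (2 < #|A|)%N -> Defs.skew A -> l \in A ->
  exists m m', [/\ m \in A, m' \in A, common_points l m = set0,
    common_points l m' = set0 & common_points m m' = set0].
Proof.
move=> A3 sA lA; have : (1 < #|A :\ l|)%N by move: A3; rewrite (cardsD1 l) lA.
case/card_gt1P=> m [m' [/setD1P[ml mA] /setD1P[ml' mA'] mm']].
have s k : k \in A -> k != l -> common_points l k = set0.
  by move=> kA kl; apply: sA; rewrite // eq_sym.
exists m, m'; split; [exact: mA | exact: mA' | exact: s | exact: s |].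
exact: sA.
Qed.

Lemma line_add_skew l m t : common_points l m = set0 ->
  common_points t l != set0 -> common_points t m != set0 ->
  (val t <= val l + val m)%VS.
Proof.
move=> lm /set0Pn[p /setIP[pt pl]] /set0Pn[p' /setIP[pt' pm]].
have pp' : p != p'.
  by apply: contra_eqT lm => /negPn/eqP e; apply/set0Pn; exists p;
    rewrite inE pl e.
rewrite (line_through pp' pt pt'); apply: addvS; first by rewrite inE in pl.
by rewrite inE in pm.
Qed.

(** Two skew lines of [A] span [W]. The lines of [B] meet both, hence lie in [W]; two of them again
    span [W], which brings in the remaining lines of [A]. *)
Lemma grid_regulus A B : grid A B -> exists2 W, regulus W A & opposite W A = B.
Proof.
move=> gAB; have [cA cB dAB covA covB] := gAB.
have sB := grid_skew gAB; have sA := grid_skew (grid_sym gAB).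
have meet l m : l \in A -> m \in B -> common_points l m != set0.
  by move=> lA mB; rewrite -card_gt0 (grid_card_common gAB lA mB).
have [l lA] : exists l, l \in A by apply/card_gt0P; rewrite cA.
have [m mB] : exists m, m \in B by apply/card_gt0P; rewrite cB.
have A3 : (2 < #|A|)%N by rewrite cA ltnS card_finNzRing_gt1.
have B3 : (2 < #|B|)%N by rewrite cB ltnS card_finNzRing_gt1.
have [l2 [l3 [l2A l3A s12 s13 s23]]] := card_skew_triple A3 sA lA.
have [m2 [_ [m2B _ s12m _ _]]] := card_skew_triple B3 sB mB.
have dW : \dim (val l + val l2) == 4%N by rewrite dim_add_skew.
pose W : solid V := Sub (val l + val l2)%VS dW.
have BW t : t \in B -> (val t <= val W)%VS.
  by move=> tB; rewrite SubK line_add_skew // common_pointsC meet.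
have AW t : t \in A -> (val t <= val W)%VS.
  move=> tA; rewrite (solid_eq_add s12m (BW _ mB) (BW _ m2B)).
  by rewrite line_add_skew // meet.
have tE : opposite W A = B.
  apply/setP=> t; rewrite inE; apply/idP/idP => [/andP[_ /forall_inP tA]|tB].
    (* A transversal [t] meets [l] in a point [p], and the line of [B] through [p] is also a
       transversal; the two agree by uniqueness relative to [l], [l2], [l3]. *)
    have tmeet k : k \in A -> common_points t k != set0.
      by move=> kA; rewrite -card_gt0 (eqP (tA k kA)).
    have /set0Pn[p /setIP[pt pl]] := tmeet l lA.
    have [m' mB' pm'] := covA l lA p pl.
    suff -> : t = m' by [].
    by apply: (transversal_unique s12 s13 s23 pl pt pm');
      rewrite ?tmeet // common_pointsC meet.
  rewrite BW //=; apply/forall_inP => k kA.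
  by rewrite common_pointsC (grid_card_common gAB).
exists W => //; split=> //; first by apply/set0Pn; exists l.
  by move=> k kA p pk; rewrite -/(opposite W A) tE; apply: covA pk.
by move=> t; rewrite -/(opposite W A) tE => tB p; apply: covB.
Qed.

(** Both sizes come from the equality case of [card_covered]: for [S] seen from a transversal,
    uniqueness through a point is skewness; for the transversals seen from a line of [S], it is
    [transversal_unique]. *)
Lemma regulus_grid W S : regulus W S -> grid S (opposite W S).
Proof.
set T := opposite W S; move=> [/set0Pn[l lS] SW sS covS covT].
have tS t k : t \in T -> k \in S -> #|common_points t k| = 1%N.
  by rewrite inE => /andP[_ /forall_inP tA] /tA/eqP.
have dST : [disjoint S & T].
  (* A line in both families would meet itself in exactly one point, although it has q + 1
     points. *)
  rewrite disjoint_subset; apply/subsetP => k kS; rewrite inE.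
  apply/negP => kT; have := tS k k kT kS.
  rewrite common_pointsxx card_points_on => -[q0].
  by have := card_finNzRing_gt1 F; rewrite q0.
have skew_uniq k k' p : k \in S -> k' \in S ->
    p \in points_on k -> p \in points_on k' -> k = k'.
  move=> kS kS' pk pk'; apply/eqP/negPn/negP => /(sS _ _ kS kS') s.
  by move: (in_set0 p); rewrite -s inE pk pk'.
have [p pl] : exists p, p \in points_on l.
  by apply/card_gt0P; rewrite card_points_on.
have [t tT pt] := covS l lS p pl.
have cS : #|S| = #|F|.+1.
  have [_ e] := card_covered (negbT (disjointFl dST tT)) (covT t tT).
  apply/esym/eqP; rewrite e; apply/andP; split; last first.
    by apply/forall_inP => k kS; rewrite tS.
  apply/forall_inP => r rt; have [k kS rk] := covT t tT r rt.
  apply/cards1P; exists k; apply/setP => k'; rewrite [LHS]inE [RHS]inE.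
  by apply/andP/eqP => [[kS' rk']|-> //]; apply: (skew_uniq _ _ r).
have S3 : (2 < #|S|)%N by rewrite cS ltnS card_finNzRing_gt1.
have [l2 [l3 [l2S l3S s12 s13 s23]]] := card_skew_triple S3 sS lS.
have tmeet u k : u \in T -> k \in S -> common_points u k != set0.
  by move=> uT kS; rewrite -card_gt0 tS.
split=> //.
have [_ e] := card_covered (negbT (disjointFr dST lS)) (covS l lS).
apply/esym/eqP; rewrite e; apply/andP; split; last first.
  by apply/forall_inP => u uT; rewrite common_pointsC tS.
apply/forall_inP => r rl; have [u uT ru] := covS l lS r rl.
apply/cards1P; exists u; apply/setP => u'.
rewrite [LHS]inE [RHS]inE; apply/andP/eqP => [[uT' ru']|-> //].
by apply: (transversal_unique s12 s13 s23 rl); rewrite ?tmeet.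
Qed.

(** Two skew lines of [S] already span a 4-dimensional space. *)
Lemma regulus_solid_unique W W' S :
  regulus W S -> (forall l, l \in S -> val l <= val W')%VS -> W = W'.
Proof.
move=> rS SW'; have [/set0Pn[l lS] SW sS _ _] := rS.
have [cS _ _ _ _] := regulus_grid rS.
have S3 : (2 < #|S|)%N by rewrite cS ltnS card_finNzRing_gt1.
have [l2 [_ [l2S _ s12 _ _]]] := card_skew_triple S3 sS lS.
apply: val_inj; rewrite /= (solid_eq_add s12 (SW _ lS) (SW _ l2S)).
by rewrite (solid_eq_add s12 (SW' _ lS) (SW' _ l2S)).
Qed.

(** Meeting in one point is symmetric, which gives one inclusion; both sides have q + 1 lines. *)
Lemma opposite_opposite W S :
  regulus W S -> regulus W (opposite W S) -> opposite W (opposite W S) = S.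
Proof.
move=> rS rT; have [cS _ _ _ _] := regulus_grid rS.
have [_ cT _ _ _] := regulus_grid rT; have [_ SW _ _ _] := rS.
apply/esym/eqP; rewrite eqEcard cS cT leqnn andbT.
apply/subsetP => l lS; rewrite inE SW //=; apply/forall_inP => t.
by rewrite inE => /andP[_ /forall_inP/(_ l lS)]; rewrite common_pointsC.
Qed.

End Grids.

(** * Sums over the lines through a point, and functions of minimum support *)

Section PencilSums.
Variables (R : realType) (F : finFieldType) (V : vectType F).
Implicit Types (p : point V) (l m : line V) (W : solid V).
Implicit Types (A B S : {set line V}) (f : line V -> R).

Definition balanced f := forall p, \sum_(l | p \in points_on l) f l = 0.

(** The left side is [N^T N f] at [l]. A line [m] is counted once for each point shared with [l]: q
    + 1 times if [m = l], otherwise once or never according to adjacency. *)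
Lemma sum_pencils f l :
  \sum_(p in points_on l) \sum_(m | p \in points_on m) f m =
  (#|F|%:R + 1) * f l + \sum_(m | grassmann_adj l m) f m.
Proof.
rewrite (exchange_big_dep predT) //=.
have e m : \sum_(p in points_on l | p \in points_on m) f m =
    #|common_points l m|%:R * f m.
  by rewrite mulr_natl -sumr_const; apply: eq_bigl => p; rewrite in_setI.
under eq_bigr => m _ do rewrite e.
rewrite (bigD1 l) //= common_pointsxx card_points_on -addn1 natrD.
congr (_ + _).
rewrite [RHS]big_mkcondr [LHS](eq_bigl (fun m => l != m)); last first.
  by move=> m; rewrite eq_sym.
apply: eq_bigr => m lm; have := card_common_points_le1 lm.
by rewrite -card_gt0; case: #|_| => [|[|//]] _; rewrite ?mul0r ?mul1r.
Qed.

(* The kernel of N^T N is that of N because |N f|^2 = <f, N^T N f>. *)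
Lemma eigenfunction_balanced f :
  eigenfunction (@grassmann_adj F V) (- (#|F|%:R + 1)) f <->
  (exists l, f l != 0) /\ balanced f.
Proof.
split=> -[f0 fE]; split=> //; last first.
  move=> l; apply/eqP; rewrite mulNr -subr_eq0 -opprD oppr_eq0 -sum_pencils.
  by rewrite big1.
pose P p := \sum_(l | p \in points_on l) f l.
suff sq0 : \sum_p P p ^+ 2 = 0.
  move=> p; apply/eqP; rewrite -sqrf_eq0; apply/eqP.
  by apply: (psumr_eq0P (fun p _ => sqr_ge0 (P p)) sq0).
transitivity (\sum_l f l * \sum_(p in points_on l) P p); last first.
  by apply: big1 => l _; rewrite sum_pencils -fE mulNr addrN mulr0.
under [RHS]eq_bigr => l _ do rewrite big_distrr.
rewrite [RHS](exchange_big_dep predT) //=; apply: eq_bigr => p _.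
by rewrite expr2 {1}/P big_distrl.
Qed.

(** A vanishing sum with a positive term must have a negative one. *)
Lemma balanced_covered f : balanced f ->
  {in [set l | 0 < f l], forall l, covered [set m | f m < 0] l}.
Proof.
move=> fB l; rewrite inE => fl p pl.
have [/exists_inP[m mN pm]|none] :=
  boolP [exists m in [set m | f m < 0], p \in points_on m]; first by exists m.
have ge0 m : p \in points_on m -> 0 <= f m.
  move=> pm; rewrite leNgt; apply: contra none => fm.
  by apply/exists_inP; exists m; rewrite // inE.
by move: fl; rewrite (psumr_eq0P ge0 (fB p) pl) ltxx.
Qed.

Lemma balancedN f : balanced f -> balanced (fun l => - f l).
Proof. by move=> fB p; rewrite sumrN fB oppr0. Qed.

Lemma balanced_coveredN f : balanced f ->
  {in [set l | f l < 0], forall l, covered [set m | 0 < f m] l}.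
Proof.
move=> /balancedN/balanced_covered cov l.
rewrite inE => fl p pl; have [|m] := cov l _ p pl.
  by rewrite inE oppr_gt0.
by rewrite inE oppr_lt0 => fm pm; exists m; rewrite // inE.
Qed.

Lemma disjoint_signs f : [disjoint [set l | 0 < f l] & [set l | f l < 0]].
Proof.
rewrite disjoint_subset; apply/subsetP => l; rewrite !inE => fl.
by rewrite -leNgt ltW.
Qed.

Lemma support_sizeE f :
  support_size f = (#|[set l | (0 < f l)%R]| + #|[set l | (f l < 0)%R]|)%N.
Proof.
rewrite -cardsUI (disjoint_setI0 (disjoint_signs f)) cards0 addn0.
by congr #|pred_of_set _|; apply/setP => l; rewrite !inE neq_lt orbC.
Qed.

(** A line of either sign forces q + 1 lines of the other sign by [card_covered]; as these exist,
    the argument applies again in the opposite direction. *)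
Lemma balanced_card_signs f : (exists l, f l != 0) -> balanced f ->
  (#|F|.+1 <= #|[set l | (0 < f l)%R]|)%N /\
  (#|F|.+1 <= #|[set l | (f l < 0)%R]|)%N.
Proof.
set P := [set l | _]; set N := [set l | _] => -[l0 fl0] fB.
have PN l : l \in P -> (#|F|.+1 <= #|N|)%N.
  move=> lP; apply: (card_covered _ (balanced_covered fB lP)).
  by rewrite (disjointFr (disjoint_signs f)).
have NP l : l \in N -> (#|F|.+1 <= #|P|)%N.
  move=> lN; apply: (card_covered _ (balanced_coveredN fB lN)).
  by rewrite (disjointFl (disjoint_signs f)).
have [fN|fP] : l0 \in N \/ l0 \in P.
  by move: fl0; rewrite neq_lt => /orP[] fl; [left|right]; rewrite inE.
  have h := NP _ fN; have /card_gt0P[l lP] : (0 < #|P|)%N by apply: leq_trans h.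
  by split=> //; apply: (PN l).
have h := PN _ fP; have /card_gt0P[l lN] : (0 < #|N|)%N by apply: leq_trans h.
by split=> //; apply: (NP l).
Qed.

Lemma balanced_support_ge f : (exists l, f l != 0) -> balanced f ->
  (#|F|.+1.*2 <= support_size f)%N.
Proof.
move=> f0 fB; have [P N] := balanced_card_signs f0 fB.
by rewrite support_sizeE -addnn leq_add.
Qed.

Lemma balanced_grid f : (exists l, f l != 0) -> balanced f ->
  (support_size f <= #|F|.+1.*2)%N ->
  grid [set l | 0 < f l] [set l | f l < 0].
Proof.
move=> f0 fB; have [cP cN] := balanced_card_signs f0 fB.
rewrite support_sizeE -addnn => cPN; split.
- apply/eqP; rewrite eqn_leq cP andbT -(leq_add2r #|F|.+1).
  by apply: leq_trans cPN; rewrite leq_add2l.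
- apply/eqP; rewrite eqn_leq cN andbT -(leq_add2l #|F|.+1).
  by apply: leq_trans cPN; rewrite leq_add2r.
- exact: disjoint_signs.
- exact: balanced_covered.
- exact: balanced_coveredN.
Qed.

(** By [grid_unique] in both directions, [l] and [m] are the only lines of the grid through [p]. *)
Lemma grid_pencil_sum A B f l m p : grid A B ->
  (forall k, k \notin A -> k \notin B -> f k = 0) ->
  l \in A -> m \in B -> p \in points_on l -> p \in points_on m ->
  \sum_(k | p \in points_on k) f k = f l + f m.
Proof.
move=> gAB fz lA mB pl pm; have [_ _ dAB _ _] := gAB.
have ml : m != l by apply: contraTneq mB => ->; rewrite (disjointFr dAB lA).
rewrite (bigD1 l) //= (bigD1 m) ?pm //= big1 ?addr0 //.
move=> k /andP[/andP[pk kl] km].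
apply: fz.
  apply: contraNN kl => kA; apply/eqP.
  exact: (grid_unique (grid_sym gAB) mB kA lA pm pk pl).
apply: contraNN km => kB; apply/eqP.
exact: (grid_unique gAB lA kB mB pl pk pm).
Qed.

(** A point on a line of either family lies on exactly one line of each, so the sum is [c - c];
    through any other point all values are 0. *)
Lemma regulus_function_balanced W S c f :
  regulus W S -> regulus_function W S c f -> balanced f.
Proof.
move=> rS [fS fT fz] p; have gr := regulus_grid rS.
have [_ _ _ covS covT] := gr.
have [/existsP[l /andP[lS pl]]|none] :=
  boolP [exists l, (l \in S) && (p \in points_on l)].
  have [m mT pm] := covS l lS p pl.
  by rewrite (grid_pencil_sum gr fz lS mT pl pm) fS // fT // subrr.
have notS k : p \in points_on k -> k \notin S.
  by move=> pk; apply: contra none => kS; apply/existsP; exists k; rewrite kS.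
apply: big1 => k pk; apply: fz; first exact: notS.
by apply/negP => kT; have [l lS pl] := covT k kT p pk; case/negP: (notS l pl).
Qed.

Lemma regulus_function_neq0 W S c f : regulus W S -> c != 0 ->
  regulus_function W S c f -> exists l, f l != 0.
Proof. by move=> [/set0Pn[l lS] _ _ _ _] c0 [fS _ _]; exists l; rewrite fS. Qed.

Lemma regulus_function_support_le W S c f :
  regulus W S -> regulus_function W S c f -> (support_size f <= #|F|.+1.*2)%N.
Proof.
move=> /regulus_grid[cS cT _ _ _] [_ _ fz].
rewrite -addnn -{1}cS -cT; apply: leq_trans (leq_card_setU S (opposite W S)).
apply/subset_leq_card/subsetP => l; rewrite inE; apply: contraNT.
by rewrite in_setU negb_or => /andP[lS lT]; rewrite fz.
Qed.

Lemma balanced_regulus f : (exists l, f l != 0) -> balanced f ->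
  (support_size f <= #|F|.+1.*2)%N ->
  exists (W : solid V) (S : {set line V}) (c : R),
    [/\ regulus W S, c != 0 & regulus_function W S c f].
Proof.
move=> f0 fB fle; have gr := balanced_grid f0 fB fle.
set P := [set l | 0 < f l] in gr; set N := [set l | f l < 0] in gr.
have [W rP oP] := grid_regulus gr.
have fz k : k \notin P -> k \notin N -> f k = 0.
  by rewrite !inE -!leNgt => k1 k2; apply/le_anti; rewrite k1.
(* The pencil sum at the common point of [k] and [m] is [f k + f m]. Since every line of [P] meets
   every line of [N], this makes [f] constant on each of the two families. *)
have opp k m : k \in P -> m \in N -> f m = - f k.
  move=> kP mN; have /eqP/cards1P[p ke] := grid_card_common gr kP mN.
  have : p \in common_points k m by rewrite ke set11.
  rewrite in_setI => /andP[pk pm]; apply/eqP.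
  by rewrite -subr_eq0 opprK addrC -(grid_pencil_sum gr fz kP mN pk pm) fB.
have [cP cN _ _ _] := gr.
have [k kP] : exists k, k \in P by apply/card_gt0P; rewrite cP.
have [m mN] : exists m, m \in N by apply/card_gt0P; rewrite cN.
exists W, P, (f k); split=> //.
  by move: kP; rewrite inE; apply: lt0r_neq0.
split.
- by move=> k' kP'; apply: oppr_inj; rewrite -(opp k' m) // (opp k m).
- by rewrite oP => m' mN'; apply: opp.
- by rewrite oP.
Qed.

(** The real values [d], [- d] and 0 are pairwise distinct, so [f] determines the family. *)
Lemma level_set A B d f : d != 0 -> {in A, forall l, f l = d} ->
  {in B, forall l, f l = - d} ->
  (forall l, l \notin A -> l \notin B -> f l = 0) -> A = [set l | f l == d].
Proof.
move=> d0 fA fB fz; apply/setP => l; rewrite inE.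
have [lA|lA] := boolP (l \in A); first by rewrite (fA l lA) eqxx.
have [lB|lB] := boolP (l \in B); first by rewrite (fB l lB) eqNr (negbTE d0).
by rewrite (fz l lA lB) eq_sym (negbTE d0).
Qed.

(** This makes the correspondence precise: a function determines its regulus and constant up to
    exchanging the regulus with its opposite and negating the constant. The reguli are recovered as
    level sets of [f]. *)
Lemma regulus_function_unique W W' S S' c c' f :
  regulus W S -> c != 0 -> regulus_function W S c f ->
  regulus W' S' -> c' != 0 ->
  (regulus_function W' S' c' f <->
   (S' = S /\ c' = c) \/ (S' = opposite W S /\ c' = - c)).
Proof.
move=> rS c0 [fS fT fz] rS' c'0.
have SE : S = [set l | f l == c] := level_set c0 fS fT fz.
have TE : opposite W S = [set l | f l == - c].
  apply: (@level_set _ S); rewrite ?oppr_eq0 ?opprK // => l lT lS.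
  exact: fz.
split=> [[fS' fT' fz']|].
  have S'E : S' = [set l | f l == c'] := level_set c'0 fS' fT' fz'.
  have [/set0Pn[l lS'] _ _ _ _] := rS'.
  have fl := fS' l lS'.
  have [lS|lS] := boolP (l \in S).
    have cc' : c' = c by rewrite -fl fS.
    by left; split=> //; rewrite S'E SE cc'.
  have [lT|lT] := boolP (l \in opposite W S).
    have cc' : c' = - c by rewrite -fl fT.
    by right; split=> //; rewrite S'E TE cc'.
  by case/eqP: c'0; rewrite -fl fz.
(* In both cases the lines of [S'] also lie in [W], so [W' = W]. *)
have [_ SW _ _ _] := rS; have [_ SW' _ _ _] := rS'.
case=> -[S'E ->]; rewrite {}S'E in rS' SW' *.
  by rewrite (regulus_solid_unique rS' SW).
have TW : {in opposite W S, forall l, (val l <= val W)%VS}.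
  by move=> l; rewrite inE => /andP[].
have WW := regulus_solid_unique rS' TW; rewrite WW in rS' *.
split; first exact: fT.
  by rewrite opposite_opposite // opprK.
by rewrite opposite_opposite // => l lT lS; apply: fz.
Qed.

End PencilSums.

(** * Embedding a coordinate space into [V] *)

Section RankOneTensors.
Variables (F : finFieldType) (V : vectType F).

Lemma linear_injection n : (n <= \dim {:V})%N ->
  exists psi : {linear 'rV[F]_n -> V}, injective psi.
Proof.
move=> nV; set X := take n (vbasis {:V}).
have sX : size X == n by rewrite size_takel // size_tuple.
have fX : free X.
  have := basis_free (vbasisP {:V}).
  by rewrite -{1}(cat_take_drop n (vbasis {:V})) => /catl_free.
pose psi (M : 'rV[F]_n) := \sum_(i < n) M 0 i *: X`_i.
have psiL : linear psi.
  move=> k M N; rewrite /psi scaler_sumr -big_split; apply: eq_bigr => i _.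
  by rewrite !mxE scalerDl scalerA.
pose pL := GRing.isLinear.Build _ _ _ _ psi psiL.
pose psiLL : {linear 'rV[F]_n -> V} := HB.pack psi pL.
exists psiLL => M N /eqP; rewrite -subr_eq0 -raddfB => /eqP MN0.
apply/eqP; rewrite -subr_eq0; apply/eqP/rowP => i; rewrite [RHS]mxE.
have /freeP fX' : free (Tuple sX) by [].
exact: (fX' (fun i => (M - N) 0 i) MN0 i).
Qed.

End RankOneTensors.

(** * The rulings of a quadric of rank one tensors, and the main result *)

Section Rulings.
Variables (F : finFieldType) (V : vectType F).
Implicit Types (p : point V) (l m : line V) (o : option F).

(** Representatives (1, x) and (0, 1) of the q + 1 points of the projective line over [F]. *)
Definition direction o : 'rV[F]_2 :=
  if o is Some x then \row_j (if j == 0 then 1 else x) else delta_mx 0 1.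

Lemma direction_scale (a : 'rV[F]_2) : a != 0 ->
  exists k o, k != 0 /\ a = k *: direction o.
Proof.
move=> a0; have [z|z] := eqVneq (a 0 0) 0; last first.
  exists (a 0 0), (Some ((a 0 0)^-1 * a 0 1)); split=> //; apply/rowP => j.
  rewrite !mxE; have [->|j1] : j = 0 \/ j = 1.
    by case: j => [[|[|//]] ?]; [left|right]; apply: val_inj.
  + by rewrite eqxx mulr1.
  + by rewrite j1 mulVKf.
have aE : a = a 0 1 *: direction None.
  apply/rowP => j; rewrite !mxE; have [->|->] : j = 0 \/ j = 1.
    by case: j => [[|[|//]] ?]; [left|right]; apply: val_inj.
  + by rewrite z mulr0.
  + by rewrite mulr1.
exists (a 0 1), None; split=> //.
by apply: contraNneq a0 => a1; rewrite aE a1 scale0r.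
Qed.

(** Here [phi a b] stands for the tensor of [a] and [b]. Keeping it abstract lets the same lemmas
    serve both rulings, with the arguments taken in either order. *)
Variable phi : 'rV[F]_2 -> {linear 'rV[F]_2 -> V}.
Hypothesis phi_inj : forall a, a != 0 -> injective (phi a).
Hypothesis phiZ : forall k a b, phi (k *: a) b = phi a (k *: b).

Definition ruling a : {vspace V} := limg (linfun (phi a)).

Lemma rulingP a v : reflect (exists b, v = phi a b) (v \in ruling a).
Proof.
apply: (iffP memv_imgP) => [[b _ ->]|[b ->]]; exists b; rewrite ?lfunE //.
exact: memvf.
Qed.

Lemma dim_ruling a : a != 0 -> \dim (ruling a) == 2%N.
Proof.
move=> a0; rewrite limg_dim_eq ?dimvf /dim /=; first by rewrite mul1n.
apply/eqP; rewrite capfv; apply/lker0P => x y; rewrite !lfunE; exact: phi_inj.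
Qed.

Lemma rulingZ k a : k != 0 -> ruling (k *: a) = ruling a.
Proof.
move=> k0; apply/vspaceP => v; apply/rulingP/rulingP => -[b ->].
  by exists (k *: b).
by exists (k^-1 *: b); rewrite phiZ scalerA mulfV // scale1r.
Qed.

Definition ruling_weight l := #|[set a | (a != 0) && (ruling a == val l)]|.

(** For each nonzero [a], the line [ruling a] passes through [p] exactly when [v = phi a b] for some
    [b], which is then unique. The right side is symmetric in the two arguments, hence the same for
    both rulings. *)
Lemma sum_ruling_weight p v : v != 0 -> val p = <[v]>%VS ->
  (\sum_(l | p \in points_on l) ruling_weight l)%N =
  (\sum_a \sum_b (v == phi a b))%N.
Proof.
move=> v0 pv; have phi0 b : phi 0 b = 0.
  by rewrite -(scale0r (0 : 'rV[F]_2)) phiZ scale0r linear0.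
transitivity (\sum_(a | a != 0%R) \sum_b (v == phi a b))%N; last first.
  rewrite [RHS](bigD1 0) //= [X in (X + _)%N]big1 // => b _.
  by rewrite phi0 (negbTE v0).
transitivity
  (\sum_(l | p \in points_on l) \sum_(a | a != 0%R) (ruling a == val l))%N.
  apply: eq_bigr => l _; rewrite /ruling_weight -sum1dep_card big_mkcondr.
  by apply: eq_bigr => a _; case: eqP.
rewrite exchange_big /=; apply: eq_bigr => a a0.
pose la : line V := Sub (ruling a) (dim_ruling a0).
transitivity (nat_of_bool (v \in ruling a)).
  have plaE : (p \in points_on la) = (v \in ruling a).
    by rewrite inE /= pv -memvE.
  rewrite -plaE; have [pl|pl] := boolP (p \in _).
    rewrite (bigD1 la) //= eqxx big1 // => l /andP[_ lla].
    by apply/eqP; rewrite eqb0 eq_sym; exact: lla.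
  apply: big1 => l pl'; apply/eqP; rewrite eqb0; apply: contra pl => /eqP e.
  by rewrite (_ : la = l) //; apply: val_inj.
have [/rulingP[b vE]|nv] := boolP (v \in _).
  rewrite (bigD1 b) //= vE eqxx big1 // => b' bb'; apply/eqP; rewrite eqb0.
  by apply: contraNneq bb' => /(phi_inj a0) ->.
rewrite big1 // => b _; apply/eqP; rewrite eqb0; apply: contra nv => /eqP ->.
by apply/rulingP; exists b.
Qed.

(** Proportional parameters give the same line, so the q + 1 directions yield all of them. *)
Lemma card_ruling_le : (#|[set l | ruling_weight l != 0%N]| <= #|F|.+1)%N.
Proof.
have inj : injective (val : line V -> {vspace V}) by exact: val_inj.
rewrite -(card_imset _ inj) -card_option.
apply: (@leq_trans #|[set ruling (direction o) | o : option F]|);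
  last exact: leq_imset_card.
apply/subset_leq_card.
apply/subsetP => _ /imsetP[l + ->]; rewrite inE -lt0n => /card_gt0P[a].
rewrite inE => /andP[a0 /eqP <-].
have [k [o [k0 ->]]] := direction_scale a0.
by rewrite rulingZ //; apply/imsetP; exists o.
Qed.

End Rulings.

(* Identify 2 x 2 matrices with a 4-dimensional subspace of V; the rank one
   matrices a^T b form a hyperbolic quadric ruled by the lines with a fixed and
   by the lines with b fixed.  Weighting each line by its number of parameters,
   the total weight at a point of either ruling is the number of pairs (a, b)
   representing a given vector, so the difference of the weights is balanced. *)
Lemma exists_balanced (R : realType) (F : finFieldType) (V : vectType F) :
  (4 <= \dim {:V})%N ->
  exists f : line V -> R, [/\ exists l, f l != 0, balanced f &
    (support_size f <= #|F|.+1.*2)%N].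
Proof.
move=> V4; have [psi psi_inj] := @linear_injection F V (2 * 2) V4.
pose phi a : {linear 'rV[F]_2 -> V} := psi \o mxvec \o mulmx (a^T : 'M_(2, 1)).
pose phi' b : {linear 'rV[F]_2 -> V} :=
  psi \o mxvec \o mulmxr (b : 'rV[F]_2) \o @trmx F 1 2.
have phiE a b : phi' b a = phi a b by [].
have tens_inj a b a' b' : phi a b = phi a' b' ->
    forall i j, a 0 i * b 0 j = a' 0 i * b' 0 j.
  move=> /psi_inj/(can_inj mxvecK)/matrixP e i j.
  by have := e i j; rewrite !mxE !big_ord1 !mxE.
have nz (a : 'rV[F]_2) : a != 0 -> exists i, a 0 i != 0.
  move=> a0; apply/existsP; apply: contraNT a0 => /existsPn a0.
  by apply/eqP/rowP => i; rewrite mxE; apply/eqP/negPn/a0.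
have phi_inj a : a != 0 -> injective (phi a).
  move=> /nz[i ai] b b' /tens_inj e; apply/rowP => j; exact: (mulfI ai (e i j)).
have phi'_inj b : b != 0 -> injective (phi' b).
  move=> /nz[j bj] a a'; rewrite !phiE => /tens_inj e; apply/rowP => i.
  exact: (mulIf bj (e i j)).
have phiZ k a b : phi (k *: a) b = phi a (k *: b).
  by rewrite /phi /= linearZ /= -scalemxAl -scalemxAr.
have phi'Z k b a : phi' (k *: b) a = phi' b (k *: a) by rewrite !phiE phiZ.
pose w := ruling_weight phi; pose w' := ruling_weight phi'.
exists (fun l => (w l)%:R - (w' l)%:R); split.
- have e0 : delta_mx 0 0 != 0 :> 'rV[F]_2.
    by apply/eqP => /rowP/(_ 0)/eqP; rewrite !mxE oner_eq0.
  pose l : line V := Sub (ruling phi (delta_mx 0 0)) (dim_ruling phi_inj e0).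
  exists l; rewrite subr_eq0 eqr_nat.
  (* If [l] belonged to the second ruling, with parameter [b], the tensor of (0, 1) and [b] would
     equal that of (1, 0) and some [b']; their second rows differ where [b] is nonzero. *)
  have -> : w' l = 0%N.
    apply/eqP; rewrite cards_eq0; apply/eqP/setP => b; rewrite !inE.
    apply/negP => /andP[/nz[j bj] /eqP bl].
    have : phi (delta_mx 0 1) b \in ruling phi (delta_mx 0 0).
      by rewrite -[ruling _ _]bl; apply/rulingP; exists (delta_mx 0 1).
    move=> /rulingP[b' /tens_inj/(_ 1 j)]; rewrite !mxE /= mul1r mul0r => /eqP.
    by rewrite (negbTE bj).
  by rewrite -lt0n; apply/card_gt0P; exists (delta_mx 0 0); rewrite inE e0 eqxx.
- move=> p; have [v v0 pv] := pointP p.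
  rewrite sumrB -!natr_sum (sum_ruling_weight phi_inj phiZ v0 pv).
  by rewrite (sum_ruling_weight phi'_inj phi'Z v0 pv) exchange_big /= subrr.
rewrite -addnn.
apply: leq_trans (leq_add (card_ruling_le phiZ) (card_ruling_le phi'Z)).
apply: leq_trans (leq_card_setU _ _); apply/subset_leq_card/subsetP => l.
rewrite !inE; apply: contraNT; rewrite negb_or !negbK.
move=> /andP[/eqP wl /eqP wl'].
by rewrite /w wl /w' wl' subrr.
Qed.

Theorem theorem1p1 (R : realType) (F : finFieldType) (q n : nat)
    (V : vectType F) (hq : #|F| = q) (hn : (3 <= n)%N)
    (hV : \dim {:V} = n.+1) :
  (forall f : line V -> R,
     optimal_eigenfunction (@grassmann_adj F V) (- (q%:R + 1)) f <->
     exists (W : solid V) (S : {set line V}) (c : R),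
       [/\ regulus W S, c != 0 & regulus_function W S c f])
  /\
  (forall (f : line V -> R) (W W' : solid V) (S S' : {set line V}) (c c' : R),
     regulus W S -> c != 0 -> regulus_function W S c f ->
     regulus W' S' -> c' != 0 ->
     (regulus_function W' S' c' f <->
      (S' = S /\ c' = c) \/ (S' = opposite W S /\ c' = - c))).
Proof.
split; last by move=> f W W' S S' c c'; apply: regulus_function_unique.
move=> f; rewrite -hq; split.
  move=> [/eigenfunction_balanced[f0 fB] fmin]; apply: balanced_regulus => //.
  (* The tensor example [g] bounds the minimum support by 2(q + 1), so an optimal [f] attains the
     lower bound. *)
  have [|g [g0 gB gle]] := @exists_balanced R F V; first by rewrite hV.
  by apply: leq_trans gle; apply/fmin/eigenfunction_balanced.
move=> [W [S [c [rS c0 rf]]]]; split.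
  apply/eigenfunction_balanced; split; first exact: regulus_function_neq0 rf.
  exact: regulus_function_balanced rf.
move=> g /eigenfunction_balanced[g0 gB].
apply: leq_trans (regulus_function_support_le rS rf) _.
exact: balanced_support_ge.
Qed.
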